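(* Let $n\ge 1$ be an integer, let $[\beta(i,j)]$ be the $n\times n$ matrix with $(i,j)$th entry $\beta(i,j)$, $1\le i,j\le n$, where $\beta$ is the beta function, and let $I$ be the $n\times n$ identity matrix. Then $[\beta(i,j)]$ is Birkhoff-James orthogonal to $I$ in the trace norm if and only if $n$ is even.
   Context: For $x,y>0$, $\beta(x,y)=\frac{\Gamma(x)\Gamma(y)}{\Gamma(x+y)}$; for positive integers $i,j$, $\beta(i,j)=\frac{(i-1)!(j-1)!}{(i+j-1)!}$. Let $\|\cdot\|_1$ denote the trace norm (sum of singular values) on the space of $n\times n$ real matrices. For $n\times n$ real matrices $X,Y$, $X$ is said to be Birkhoff-James orthogonal to $Y$ in the trace norm if $\|X+tY\|_1\ge \|X\|_1$ for all $t\in\mathbb{R}$. *)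

(* Defs.v *)
From HB Require Import structures.
From mathcomp Require Import all_boot all_order all_algebra.
From mathcomp Require Import polyrcf.
From mathcomp Require Import all_classical all_reals all_analysis.
Set Implicit Arguments.
Unset Strict Implicit.
Unset Printing Implicit Defensive.
Import Order.TTheory GRing.Theory Num.Theory.
Local Open Scope ring_scope.

(* Square roots of the eigenvalues of A^T A, each repeated according to its
   algebraic multiplicity.  Since A^T A is symmetric positive semidefinite, its
   characteristic polynomial splits over R with nonnegative roots, so this list
   has n entries. *)
Definition singular_values (R : rcfType) (n : nat) (A : 'M[R]_n) : seq R :=
  let p := char_poly (A^T *m A) in
  flatten [seq nseq (mup x p) (Num.sqrt x) | x <- rootsR p].

Definition trace_norm (R : rcfType) (n : nat) (A : 'M[R]_n) : R :=
  \sum_(s <- singular_values A) s.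

Definition bj_orthogonal (R : rcfType) (n : nat) (X Y : 'M[R]_n) : Prop :=
  forall t : R, trace_norm (X + t *: Y) >= trace_norm X.

(* Ordinals start at 0, hence the shift of both indices. *)
Definition beta_mx (R : realType) (n : nat) : 'M[R]_n :=
  \matrix_(i < n, j < n) beta_fun i.+1 j.+1.

(* [beta_fun] is Euler's integral; at positive integers it agrees with
   Gamma(i) Gamma(j) / Gamma(i + j) = (i-1)! (j-1)! / (i+j-1)!. *)
Lemma beta_fun_factorial (R : realType) (i j : nat) :
  (0 < i)%N -> (0 < j)%N ->
  beta_fun i j = (i.-1)`!%:R * (j.-1)`!%:R / ((i + j).-1)`!%:R :> R.
Proof.
by case: i j => [|i] [|j] // _ _; rewrite beta_fun_fact natrM /= addnS.
Qed.

(* Main.v *)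
Require Import Defs.
From mathcomp Require Import all_boot all_order all_algebra.
From mathcomp Require Import polyrcf complex ring lra zify.
From mathcomp Require Import all_classical all_reals all_analysis.
Set Implicit Arguments.
Unset Strict Implicit.
Unset Printing Implicit Defensive.
Import Order.TTheory GRing.Theory Num.Theory.
Local Open Scope ring_scope.
Local Open Scope sesquilinear_scope.

(* For a symmetric matrix A with eigenvalues l_i, the trace norm of A + t I is
   the sum of the |l_i + t|.  If no l_i vanishes, this convex function of t is
   minimal at 0 exactly when its slope there, (number of positive l_i) minus
   (number of negative l_i), is zero.  The matrix with entries 1/(i+j-1)! is the
   Hankel matrix of the moments of the (indefinite) functional for which the
   Bessel polynomials are orthogonal, with squared norms of alternating sign.
   So [beta(i,j)] is congruent to a diagonal matrix of alternating signs, and by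
   Sylvester's law of inertia the slope is 0 for even n and 1 for odd n. *)

(** * Trace norm of a shifted symmetric matrix *)

Lemma singular_values_sqr (R : rcfType) (n : nat) (A : 'M[R]_n)
    (a : 'I_n -> R) :
  char_poly (A^T *m A) = \prod_(i < n) ('X - (a i ^+ 2)%:P) ->
  perm_eq (singular_values A) [seq `|a i| | i <- enum 'I_n].
Proof.
move=> pE; rewrite /singular_values pE.
set s := [seq a i ^+ 2 | i <- enum 'I_n].
have -> : \prod_(i < n) ('X - (a i ^+ 2)%:P) = \prod_(x <- s) ('X - x%:P).
  by rewrite big_map -big_enum.
set p := \prod_(x <- s) _.
have p0 : p != 0 by rewrite monic_neq0 ?monic_prod_XsubC.
have rootsE : perm_eq (rootsR p) (undup s).
  apply: uniq_perm; rewrite ?undup_uniq ?uniq_roots // => x.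
  by rewrite mem_undup -(roots_on_rootsR p0) /= root_prod_XsubC.
have -> : [seq nseq (mup x p) (Num.sqrt x) | x <- rootsR p] =
          map (map Num.sqrt) [seq nseq (count_mem x s) x | x <- rootsR p].
  by rewrite -map_comp; apply: eq_map => x /=; rewrite map_nseq mu_prod_XsubC.
rewrite -map_flatten.
have -> : [seq `|a i| | i <- enum 'I_n] = map Num.sqrt s.
  by rewrite -[RHS]map_comp; apply: eq_map => i; rewrite /= sqrtr_sqr.
apply: perm_map; rewrite -(permPr (perm_count_undup s)).
by apply/perm_flatten/perm_map.
Qed.

Lemma trace_norm_sqr (R : rcfType) (n : nat) (A : 'M[R]_n) (a : 'I_n -> R) :
  char_poly (A^T *m A) = \prod_(i < n) ('X - (a i ^+ 2)%:P) ->
  trace_norm A = \sum_(i < n) `|a i|.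
Proof.
move=> /singular_values_sqr pE.
by rewrite /trace_norm (perm_big _ pE) big_map big_enum.
Qed.

Lemma char_poly_conj (F : fieldType) (n : nat) (P A : 'M[F]_n) :
  P \in unitmx -> char_poly (invmx P *m A *m P) = char_poly A.
Proof.
move=> Pu; rewrite /char_poly /char_poly_mx !map_mxM /=.
set Q := map_mx _ P; set Q' := map_mx _ (invmx P).
have QQ : Q' *m Q = 1%:M by rewrite -map_mxM mulVmx // map_mx1.
have {1}-> : 'X%:M = Q' *m 'X%:M *m Q by rewrite scalar_mxC -mulmxA QQ mulmx1.
by rewrite -mulmxBl -mulmxBr !det_mulmx mulrAC -det_mulmx QQ det1 mul1r.
Qed.

Lemma map_mx_real_complex_conj (R : rcfType) (m n : nat) (A : 'M[R]_(m, n)) :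
  map_mx Num.conj (map_mx (real_complex R) A) = map_mx (real_complex R) A.
Proof.
apply/matrixP => i j; rewrite !mxE; apply: conj_Creal.
by apply/complex_realP; exists (A i j).
Qed.

(** The spectral theorem is applied over [R[i]], where a real symmetric matrix is Hermitian. Its
    spectrum is real, so the eigenvalues descend to [R], while [U] stays complex. *)
Lemma real_spectral (R : rcfType) (n : nat) (A : 'M[R]_n) : A^T = A ->
  exists (l : 'I_n -> R) (U : 'M[R[i]]_n), U \is unitarymx /\
    map_mx (real_complex R) A =
    invmx U *m diag_mx (\row_i (l i)%:C%C) *m U.
Proof.
move=> Asym; set AC := map_mx _ A.
have ACh : AC \is hermsymmx.
  apply/is_hermitianmxP; rewrite expr0 scale1r.
  by rewrite /AC !map_trmx Asym map_mx_real_complex_conj.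
exists (fun i => complex.Re (spectral_diag AC 0 i)).
exists (spectralmx AC); split; first exact: spectral_unitarymx.
have /hermitian_normalmx/orthomx_spectralP {1}-> := ACh.
congr (_ *m diag_mx _ *m _); apply/rowP => i; rewrite mxE RRe_real //.
by have /mxOverP := hermitian_spectral_diag_real ACh; apply.
Qed.

Lemma trace_norm_shift (R : rcfType) (n : nat) (A : 'M[R]_n) (l : 'I_n -> R)
    (U : 'M[R[i]]_n) (t : R) :
  A^T = A -> U \in unitmx ->
  map_mx (real_complex R) A = invmx U *m diag_mx (\row_i (l i)%:C%C) *m U ->
  trace_norm (A + t *: 1%:M) = \sum_(i < n) `|l i + t|.
Proof.
move=> Asym Uu AE; apply: trace_norm_sqr.
set B := A + _.
have -> : B^T = B by rewrite /B linearD linearZ /= trmx1 Asym.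
have BE : map_mx (real_complex R) B =
    invmx U *m diag_mx (\row_i (l i + t)%:C%C) *m U.
  have -> : \row_i (l i + t)%:C%C = \row_i (l i)%:C%C + const_mx t%:C%C.
    by apply/rowP => i; rewrite !mxE rmorphD.
  rewrite linearD /= diag_const_mx mulmxDr mulmxDl -AE scalar_mxC mulmxKV //.
  by rewrite /B map_mxD map_mxZ map_mx1 scalemx1.
(* Characteristic polynomials are compared after embedding in [R[i]], where [B] squared is similar
   to the diagonal of the squares of [l i + t]. *)
apply: (map_inj_poly (@complexI R) (rmorph0 _)).
rewrite map_char_poly map_mxM BE !mulmxA mulmxK // -[_ *m _ *m diag_mx _]mulmxA.
rewrite mulmx_diag char_poly_conj // char_poly_trig ?diag_mx_is_trig //.
rewrite rmorph_prod; apply: eq_bigr => i _ /=.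
by rewrite !mxE eqxx mulr1n rmorphB /= map_polyX map_polyC -rmorphM -expr2.
Qed.

(** * Inertia under congruence *)

Lemma diag_formE (C : numClosedFieldType) (n : nat) (v : 'rV[C]_n)
    (f : 'I_n -> C) :
  (v *m diag_mx (\row_i f i) *m v^t*) 0 0 = \sum_i v 0 i * (v 0 i)^* * f i.
Proof.
by rewrite mul_mx_diag mxE; apply: eq_bigr => i _; rewrite !mxE mulrAC.
Qed.

(* Otherwise, by counting dimensions, some nonzero x supported on {d > 0} has
   x Q vanishing on {l > 0}, and the form would be both > 0 and <= 0 at x. *)
Lemma card_positive_diag_le (C : numClosedFieldType) (n : nat) (Q : 'M[C]_n)
    (l d : 'I_n -> C) :
  (forall i, l i \is Num.real) ->
  Q *m diag_mx (\row_i l i) *m Q^t* = diag_mx (\row_i d i) ->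
  (#|[set i | 0 < d i]%R| <= #|[set i | 0 < l i]%R|)%N.
Proof.
move=> l_real QlQ; rewrite leqNgt; apply/negP.
set T := [set i | _]; set S := [set i | _] => ltTS.
pose M := \matrix_(i < #|S|, j < #|T|) Q (enum_val i) (enum_val j).
have : kermx M != 0.
  rewrite -mxrank_eq0 mxrank_ker -lt0n subn_gt0.
  exact: leq_ltn_trans (rank_leq_col M) ltTS.
case/rowV0Pn => x /sub_kermxP xM x0.
pose y := x *m rowsub enum_val Q.
have yT j : 0 < l j -> y 0 j = 0.
  move=> lj; have jT : j \in T by rewrite inE.
  have /rowP/(_ (enum_rank_in jT j)) := xM.
  rewrite !mxE => xMj; rewrite -[RHS]xMj.
  by apply: eq_bigr => k _; rewrite !mxE enum_rankK_in.
have : y *m diag_mx (\row_i l i) *m y^t* =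
       x *m diag_mx (\row_i d (enum_val i)) *m x^t*.
  rewrite /y trmx_mul map_mxM /= !mulmxA; congr (_ *m _).
  rewrite -!mulmxA; congr (_ *m _).
  have -> : diag_mx (\row_i d (enum_val i)) =
            mxsub enum_val enum_val (diag_mx (\row_i d i)) :> 'M[C]_(#|S|).
    by apply/matrixP => i j; rewrite !mxE (inj_eq enum_val_inj).
  rewrite -QlQ -mulmxA mxsub_mul -mulmx_colsub; congr (_ *m (_ *m _)).
  by apply/matrixP => i j; rewrite !mxE.
move=> /matrixP/(_ 0 0); rewrite !diag_formE => yE.
have le0 : \sum_j y 0 j * (y 0 j)^* * l j <= 0.
  apply: sumr_le0 => j _; have [/yT->|] := boolP (0 < l j).
    by rewrite !mul0r.
  by rewrite -real_leNgt // => lj; rewrite mulr_ge0_le0 ?mul_conjC_ge0.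
rewrite {}yE in le0.
have [k xk] : exists k, x 0 k != 0 by apply/rV0Pn.
have dgt0 (i : 'I_#|S|) : 0 < d (enum_val i).
  by have := enum_valP i; rewrite inE.
suff /lt_le_trans/(_ le0) : 0 < \sum_j x 0 j * (x 0 j)^* * d (enum_val j).
  by rewrite ltxx.
rewrite (bigD1 k) //= ltr_pwDl //.
  by rewrite mulr_gt0 // lt_def mul_conjC_ge0 mulf_neq0 ?conjC_eq0.
by apply: sumr_ge0 => i _; rewrite mulr_ge0 ?mul_conjC_ge0 ?ltW.
Qed.

Lemma card_negative_diag_le (C : numClosedFieldType) (n : nat) (Q : 'M[C]_n)
    (l d : 'I_n -> C) :
  (forall i, l i \is Num.real) ->
  Q *m diag_mx (\row_i l i) *m Q^t* = diag_mx (\row_i d i) ->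
  (#|[set i | (d i < 0)%R]| <= #|[set i | (l i < 0)%R]|)%N.
Proof.
move=> l_real QlQ.
have diagN (f : 'I_n -> C) : diag_mx (\row_i - f i) = - diag_mx (\row_i f i).
  by rewrite -linearN; congr diag_mx; apply/rowP => i; rewrite !mxE.
have := @card_positive_diag_le C n Q (fun i => - l i) (fun i => - d i).
have negE (f : 'I_n -> C) : [set i | 0 < - f i] = [set i | f i < 0].
  by apply/setP => i; rewrite !inE oppr_gt0.
rewrite !diagN mulmxN mulNmx QlQ !negE.
by apply=> // i; rewrite realN.
Qed.

(** Composing [P] with the inverse of [U] gives a complex congruence between the two diagonals.
    Inequalities suffice later, because there the two counts for [d] add up to [n]. *)
Lemma sylvester_card_le (R : rcfType) (n : nat) (A P : 'M[R]_n)
    (l d : 'I_n -> R) (U : 'M[R[i]]_n) :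
  U \is unitarymx ->
  map_mx (real_complex R) A = invmx U *m diag_mx (\row_i (l i)%:C%C) *m U ->
  P *m A *m P^T = diag_mx (\row_i d i) ->
  (#|[set i | (0 < d i)%R]| <= #|[set i | (0 < l i)%R]|)%N /\
  (#|[set i | (d i < 0)%R]| <= #|[set i | (l i < 0)%R]|)%N.
Proof.
move=> Uu AE PAP; pose Q := map_mx (real_complex R) P *m invmx U.
have l_real i : (l i)%:C%C \is Num.real by apply/complex_realP; exists (l i).
have QlQ : Q *m diag_mx (\row_i (l i)%:C%C) *m Q^t* =
           diag_mx (\row_i (d i)%:C%C).
  rewrite /Q trmx_mul map_mxM /= invmx_unitary // trmxCK -invmx_unitary //.
  rewrite map_trmx map_mx_real_complex_conj.
  transitivity (map_mx (real_complex R) (P *m A *m P^T)).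
    by rewrite !map_mxM AE !mulmxA.
  rewrite PAP map_diag_mx; congr diag_mx.
  by apply/rowP => i; rewrite !mxE.
have /= := card_positive_diag_le l_real QlQ.
have /= := card_negative_diag_le l_real QlQ.
have posE (f : 'I_n -> R) : [set i | 0 < (f i)%:C%C] = [set i | 0 < f i].
  by apply/setP => i; rewrite !inE ltcR.
have negE (f : 'I_n -> R) : [set i | (f i)%:C%C < 0] = [set i | f i < 0].
  by apply/setP => i; rewrite !inE ltcR.
by rewrite !posE !negE.
Qed.

(** * Alternating binomial sums *)

(** Pascal's rule splits the sum in two. This trades one order of differencing for a difference of
    [f], which drives the inductions on [k] below. *)
Lemma alternating_binomial_sumS (R : comPzRingType) (k : nat) (f : nat -> R) :
  \sum_(m < k.+2) (-1) ^+ m * 'C(k.+1, m)%:R * f m =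
  \sum_(m < k.+1) (-1) ^+ m * 'C(k, m)%:R * (f m - f m.+1).
Proof.
under [RHS]eq_bigr do rewrite mulrBr.
rewrite sumrB big_ord_recl.
under eq_bigr do rewrite lift0 binS natrD mulrDr mulrDl.
rewrite big_split /= addrA; congr (_ + _).
  rewrite [in RHS]big_ord_recl !bin0; congr (_ + _).
  rewrite big_ord_recr /= bin_small // mulr0 mul0r addr0.
  by apply: eq_bigr.
by rewrite -sumrN; apply: eq_bigr => m _; rewrite exprS mulN1r !mulNr.
Qed.

Lemma ffact_subS (n c : nat) : (n.+1 ^_ c.+1 = n ^_ c.+1 + c.+1 * n ^_ c)%N.
Proof.
rewrite ffactSS ffactnSr; have [lt|le] := ltnP n c.
  by rewrite ffact_small // !muln0.
by rewrite [(c.+1 * _)%N]mulnC -mulnDr mulnC addnS subnK.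
Qed.

(* The k-th finite difference kills polynomials of degree less than k. *)
Lemma alternating_binomial_ffact (R : comPzRingType) (k c a : nat) :
  (c < k)%N ->
  \sum_(m < k.+1) (-1) ^+ m * 'C(k, m)%:R * ((m + a) ^_ c)%:R = 0 :> R.
Proof.
elim: k c a => // k IHk [|c] a lt_ck;
  rewrite (alternating_binomial_sumS k (fun m => ((m + a) ^_ _)%:R)).
  by apply: big1 => m _; rewrite !ffactn0 subrr mulr0.
transitivity (\sum_(m < k.+1)
    - c.+1%:R * ((-1) ^+ m * 'C(k, m)%:R * ((m + a) ^_ c)%:R : R)).
  apply: eq_bigr => m _.
  by rewrite addSn ffact_subS natrD opprD addNKr natrM; ring.
by rewrite -mulr_sumr IHk // mulr0.
Qed.

(** Both sides are the integral of x^a (1-x)^k over [0,1], the left one after expanding (1-x)^k. The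
    proof is a purely algebraic induction on [k]. *)
Lemma alternating_binomial_inv (R : numFieldType) (k a : nat) :
  \sum_(m < k.+1) (-1) ^+ m * 'C(k, m)%:R * (m + a).+1%:R^-1 =
  (k`! * a`!)%:R / (k + a).+1`!%:R :> R.
Proof.
elim: k a => [|k IHk] a.
  rewrite big_ord1 expr0 bin0 !mul1r add0n mul1n factS natrM invfM mulrCA.
  by rewrite divff ?mulr1 // pnatr_eq0 -lt0n fact_gt0.
rewrite (alternating_binomial_sumS k (fun m => (m + a).+1%:R^-1)).
under eq_bigr => m _ do rewrite mulrBr addSnnS.
rewrite sumrB !IHk addnS addSn [(k + a).+2`!]factS [a.+1`!]factS [k.+1`!]factS.
have : (k + a).+1`!%:R != 0 :> R by rewrite pnatr_eq0 -lt0n fact_gt0.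
have : (k + a).+2%:R != 0 :> R by rewrite pnatr_eq0.
move: (k + a).+1`! k`! a`! => N K A; rewrite !natrM -!natr1 natrD => nz1 nz2.
field.
by rewrite nz1 nz2.
Qed.

(** * Diagonalising the beta matrix by Bessel coefficients *)

(** [P *m B] and [P^T] are both upper triangular, hence so is their product; being symmetric, it is
    diagonal. *)
Lemma congruent_diag (R : comNzRingType) (n : nat) (P B : 'M[R]_n) :
  B^T = B -> (forall i j : 'I_n, (i < j)%N -> P i j = 0) ->
  (forall i j : 'I_n, (j < i)%N -> (P *m B) i j = 0) ->
  P *m B *m P^T = diag_mx (\row_i ((P *m B) i i * P i i)).
Proof.
move=> Bsym Plow PBup; set M := P *m B *m P^T.
have Msym : M^T = M by rewrite /M !trmx_mul trmxK Bsym mulmxA.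
have Mlow (i j : 'I_n) : (j < i)%N -> M i j = 0.
  move=> ji; rewrite mxE big1 // => m _; rewrite [P^T _ _]mxE.
  have [mi|im] := ltnP m i; first by rewrite PBup ?mul0r.
  by rewrite Plow ?mulr0 // (leq_trans ji).
apply/matrixP => i j; rewrite [RHS]mxE.
case: (ltngtP i j) => [ij|ji|/val_inj <-].
- by rewrite -Msym mxE Mlow // -val_eqE ltn_eqF.
- by rewrite Mlow // -val_eqE gtn_eqF.
rewrite eqxx mulr1n mxE [RHS]mxE (bigD1 i) //= big1 => [|m mi];
  rewrite [P^T _ _]mxE ?addr0 //.
move: mi; rewrite -val_eqE neq_ltn => /orP[mi|im].
  by rewrite PBup ?mul0r.
by rewrite Plow ?mulr0.
Qed.

(* Up to a factor depending on k only, this is 1/m! times the coefficient of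
   x^m in the Bessel polynomial y_k(-2x); the factor 1/m! absorbs the
   (i-1)! (j-1)! that distinguishes beta(i,j) from 1/(i+j-1)!. *)
Definition bessel_coef (R : realType) (k m : nat) : R :=
  (-1) ^+ m * 'C(k, m)%:R * (k + m)`!%:R / m`!%:R.

Definition bessel_mx (R : realType) (n : nat) : 'M[R]_n :=
  \matrix_(i < n, j < n) bessel_coef R i j.

Lemma bessel_mul_beta (R : realType) (n : nat) (k j : 'I_n) :
  (bessel_mx R n *m beta_mx R n) k j =
  j`!%:R * \sum_(m < k.+1)
    (-1) ^+ m * 'C(k, m)%:R * ((k + m)`!%:R / (m + j).+1`!%:R).
Proof.
rewrite mxE mulr_sumr.
rewrite (big_ord_widen n (fun m => j`!%:R * ((-1) ^+ m * 'C(k, m)%:R *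
  ((k + m)`!%:R / (m + j).+1`!%:R)))) // [RHS]big_mkcond /=.
apply: eq_bigr => m _; rewrite !mxE beta_fun_fact natrM ltnS /bessel_coef.
case: leqP => [_|km]; last by rewrite bin_small // mulr0 !mul0r.
have : m`!%:R != 0 :> R by rewrite pnatr_eq0 -lt0n fact_gt0.
have : (m + j).+1`!%:R != 0 :> R by rewrite pnatr_eq0 -lt0n fact_gt0.
move: (m + j).+1`! (k + m)`! m`! j`! => a b c d a0 c0; field.
by rewrite a0 c0.
Qed.

(** The quotient (k+m)!/(m+j+1)! is a falling factorial of m+k of length k-j-1, a polynomial in m of
    degree less than k. *)
Lemma bessel_mul_beta_lt (R : realType) (n : nat) (k j : 'I_n) : (j < k)%N ->
  (bessel_mx R n *m beta_mx R n) k j = 0.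
Proof.
move=> jk; rewrite bessel_mul_beta.
rewrite -[X in _ * X](@eq_bigr _ _ _ _ _ _
  (fun m : 'I_k.+1 => (-1) ^+ m * 'C(k, m)%:R * ((m + k) ^_ (k - j.+1))%:R)).
  by rewrite alternating_binomial_ffact ?mulr0 // ltn_subrL (leq_trans _ jk).
move=> m _; congr (_ * _).
have le : (k - j.+1 <= m + k)%N by lia.
have -> : (m + j).+1 = (m + k - (k - j.+1))%N by lia.
by rewrite [in RHS]addnC -[in RHS](ffact_fact le) natrM mulfK.
Qed.

(** For j = k the factorial quotient is 1/(m+k+1), so the sum is the inverse one with [a] equal to
    [k]. *)
Lemma bessel_mul_beta_diag (R : realType) (n : nat) (k : 'I_n) :
  (bessel_mx R n *m beta_mx R n) k k =
  k`!%:R * ((k`! * k`!)%:R / (k + k).+1`!%:R).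
Proof.
rewrite bessel_mul_beta -alternating_binomial_inv; congr (_ * _).
apply: eq_bigr => m _; congr (_ * _); rewrite factS natrM addnC invfM mulrCA.
by rewrite divff ?mulr1 // pnatr_eq0 -lt0n fact_gt0.
Qed.

Lemma bessel_beta_congr (R : realType) (n : nat) :
  exists2 e : 'I_n -> R, forall i, 0 < e i &
    bessel_mx R n *m beta_mx R n *m (bessel_mx R n)^T =
    diag_mx (\row_i ((-1) ^+ i * e i)).
Proof.
have fact_gt0r (m : nat) : 0 < m`!%:R :> R by rewrite ltr0n fact_gt0.
(* The diagonal entry of the product with the beta matrix, times the leading coefficient (2i)!/i!
   stripped of its sign. *)
exists (fun i : 'I_n => i`!%:R * ((i`! * i`!)%:R / (i + i).+1`!%:R)
                        * ((i + i)`!%:R / i`!%:R)).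
  by move=> i; rewrite natrM !(mulr_gt0, invr_gt0).
rewrite congruent_diag; first 1 last.
- by apply/matrixP => i j; rewrite !mxE !beta_fun_fact mulnC addnC.
- by move=> i j ij; rewrite mxE /bessel_coef bin_small // mulr0 !mul0r.
- exact: bessel_mul_beta_lt.
congr diag_mx; apply/rowP => i; rewrite [LHS]mxE [RHS]mxE bessel_mul_beta_diag.
by rewrite mxE /bessel_coef binn mulr1 -[_ * _ / _]mulrA mulrCA.
Qed.

(** * Sign counts and minimality at zero *)

Lemma card_even_ord (n : nat) : #|[set i : 'I_n | ~~ odd i]| = uphalf n.
Proof.
rewrite -sum1dep_card big_mkcond /=.
elim: n => [|n IHn]; first by rewrite big_ord0.
rewrite big_ord_recr /= IHn uphalf_half.
by case: (odd n); rewrite ?addn0 ?addn1.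
Qed.

Lemma card_odd_ord (n : nat) : #|[set i : 'I_n | odd i]| = n./2.
Proof.
rewrite -sum1dep_card big_mkcond /=.
elim: n => [|n IHn]; first by rewrite big_ord0.
by rewrite big_ord_recr /= IHn uphalf_half addnC; case: (odd n).
Qed.

Lemma sum_sgr (R : realDomainType) (n : nat) (l : 'I_n -> R) :
  \sum_i Num.sg (l i) = #|[set i | 0 < l i]|%:R - #|[set i | (l i < 0)%R]|%:R.
Proof.
rewrite -!sum1dep_card !natr_sum [X in X - _]big_mkcond [X in _ - X]big_mkcond.
by rewrite -sumrB; apply: eq_bigr => i _ /=; case: sgrP => _; lra.
Qed.

Lemma sum_normD_ge_iff (R : realFieldType) (n : nat) (l : 'I_n -> R) :
  (forall i, l i != 0) ->
  (forall t : R, \sum_i `|l i| <= \sum_i `|l i + t|) <->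
  \sum_i Num.sg (l i) = 0.
Proof.
move=> l0; split=> [min0|sum0 t]; last first.
  (* Each |l i| + t sg(l i) is a tangent line at t = 0, lying below |l i + t|; with zero total slope
     the tangents sum to the value at 0. *)
  have -> : \sum_i `|l i| = \sum_i (`|l i| + t * Num.sg (l i)).
    by rewrite big_split /= -mulr_sumr sum0 mulr0 addr0.
  apply: ler_sum => i _; case: sgrP (l0 i) => // [li|li] _.
    by rewrite mulr1 ler_norm.
  by rewrite mulrN1 -opprD ler_normr lexx orbT.
set s := \sum_i Num.sg (l i).
have [e e0 le_e] : exists2 e : R, 0 < e & forall i, e <= `|l i|.
  exists (\big[Num.min/1]_i `|l i|).
    by apply: lt_bigmin => // i _; rewrite normr_gt0.
  by move=> i; apply: bigmin_le.
(* A step of length at most [e] changes no sign, so every term is affine there. Moving against the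
   slope [s] lowers the sum by e|s|, and minimality forces s = 0. *)
have normD i : `|l i - e * Num.sg s| = `|l i| - e * Num.sg s * Num.sg (l i).
  have : `|e * Num.sg s| <= `|l i|.
    rewrite (le_trans _ (le_e i)) // normrM gtr0_norm // ler_piMr ?(ltW e0) //.
    by rewrite normr_sg lern1 leq_b1.
  move: (e * _) => t; rewrite ler_norml.
  case: sgrP (l0 i) => // [li|li] _ /andP[? ?].
    by rewrite mulr1 ger0_norm // subr_ge0.
  by rewrite mulrN1 ler0_norm; lra.
have := min0 (- (e * Num.sg s)).
under [X in _ <= X -> _]eq_bigr do rewrite normD.
rewrite sumrB -mulr_sumr -/s -mulrA -normrEsg lerDl oppr_ge0.
by rewrite pmulr_rle0 // normr_le0 => /eqP.
Qed.

Lemma bj_orthogonal1_iff (R : rcfType) (n : nat) (A : 'M[R]_n) (l : 'I_n -> R)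
    (U : 'M[R[i]]_n) :
  A^T = A -> U \in unitmx ->
  map_mx (real_complex R) A = invmx U *m diag_mx (\row_i (l i)%:C%C) *m U ->
  (forall i, l i != 0) ->
  bj_orthogonal A 1%:M <-> \sum_i Num.sg (l i) = 0.
Proof.
move=> Asym Uu AE l0; rewrite -sum_normD_ge_iff //.
have normE := trace_norm_shift _ Asym Uu AE.
have norm0 : trace_norm A = \sum_i `|l i|.
  rewrite -[A]addr0 -(scale0r 1%:M) normE.
  by under eq_bigr do rewrite addr0.
by split=> bj t; have := bj t; rewrite normE norm0.
Qed.

Theorem theorem1p2 (R : realType) (n : nat) (hn : (1 <= n)%N) :
  bj_orthogonal (beta_mx R n) 1%:M <-> ~~ odd n.
Proof.
have Asym : (beta_mx R n)^T = beta_mx R n.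
  by apply/matrixP => i j; rewrite !mxE !beta_fun_fact mulnC addnC.
have [l [U [Uu AE]]] := real_spectral Asym.
have [e e0 congr_e] := bessel_beta_congr R n.
have [lePos leNeg] := sylvester_card_le Uu AE congr_e.
have posE : [set i : 'I_n | 0 < (-1) ^+ i * e i] = [set i : 'I_n | ~~ odd i].
  apply/setP => i; rewrite !inE pmulr_lgt0 // -signr_odd.
  by case: (odd i); rewrite ?ltr01 // expr1 oppr_gt0 ltr10.
have negE : [set i : 'I_n | (-1) ^+ i * e i < 0] = [set i : 'I_n | odd i].
  apply/setP => i; rewrite !inE pmulr_llt0 // -signr_odd.
  by case: (odd i); rewrite ?ltr10 // expr1 oppr_lt0 ltr01.
(* Indices start at 0, so the positive entries are the ones in the rounded-up half. *)
rewrite posE card_even_ord in lePos; rewrite negE card_odd_ord in leNeg.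
set pos := [set i | _] in lePos; set neg := [set i | _] in leNeg.
have dis : [disjoint pos & neg].
  rewrite -setI_eq0; apply/eqP/setP => i; rewrite !inE.
  by case: ltgtP.
have cardU : #|pos :|: neg| = (#|pos| + #|neg|)%N.
  by rewrite cardsU disjoint_setI0 // cards0 subn0.
have le_n : (#|pos :|: neg| <= n)%N.
  by rewrite -[X in (_ <= X)%N]card_ord max_card.
have halfE := uphalf_half n; have oddE := odd_double_half n.
(* The two halves add up to [n], and the disjoint sets [pos] and [neg] have at most [n] elements
   together: both bounds are equalities and no eigenvalue vanishes. *)
have /subset_cardP/(_ (subset_predT _)) full : #|pos :|: neg| = #|'I_n|.
  by rewrite card_ord; lia.
have l0 i : l i != 0 by have := full i; rewrite !inE; case: ltgtP.
rewrite (bj_orthogonal1_iff Asym (unitarymx_unit Uu) AE l0) sum_sgr -/pos -/neg.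
have -> : #|pos| = (#|neg| + odd n)%N by lia.
rewrite natrD addrC addKr; case: (odd n) => /=; split=> //.
by move/eqP; rewrite oner_eq0.
Qed.
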